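(* Let $Q$ be a magma with two-sided neutral element $1$ and with two-sided inverses, that is, $1\cdot x = x\cdot 1 = x$ and $x\cdot x^{-1} = x^{-1}\cdot x = 1$ hold for every $x\in Q$. Suppose that $Q$ satisfies at least one of the following identities (for all $x,y,z\in Q$): (LB) $(x\cdot (y\cdot x))\cdot z = x\cdot (y\cdot (x\cdot z))$; (M1) $((x\cdot y)\cdot x)\cdot z = x\cdot (y\cdot (x\cdot z))$; (M2) $x\cdot (y\cdot (z\cdot y)) = ((x\cdot y)\cdot z)\cdot y$; (C) $x\cdot (y\cdot (y\cdot z)) = ((x\cdot y)\cdot y)\cdot z$. Then $Q$ is a loop.
   Context: A magma here is a set with a single binary operation $\cdot$ possessing a two-sided neutral element $1$. No associativity is assumed. For each $x$, $x^{-1}$ denotes an element of $Q$ with the stated property. A loop is a magma (with two-sided neutral element) in which every equation $x\cdot y = z$ has a unique solution whenever two of the elements $x,y,z$ are specified; equivalently, all left translations $y\mapsto x\cdot y$ and all right translations $y\mapsto y\cdot x$ are bijections. *)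

(* Defs.v *)
From mathcomp Require Import all_boot.

Set Implicit Arguments.
Unset Strict Implicit.
Unset Printing Implicit Defensive.

Local Open Scope group_scope.

Definition LB (Q : magmaType) : Prop :=
  forall x y z : Q, (x * (y * x)) * z = x * (y * (x * z)).

Definition M1 (Q : magmaType) : Prop :=
  forall x y z : Q, ((x * y) * x) * z = x * (y * (x * z)).

Definition M2 (Q : magmaType) : Prop :=
  forall x y z : Q, x * (y * (z * y)) = ((x * y) * z) * y.

Definition C (Q : magmaType) : Prop :=
  forall x y z : Q, x * (y * (y * z)) = ((x * y) * y) * z.

(* The library's [umagmaType] would add a choice structure on the carrier, so
   the neutrality of 1 is stated separately over the axiom-free
   [baseUMagmaType]. *)
Definition has_neutral (Q : baseUMagmaType) : Prop :=
  left_id (1 : Q) *%g /\ right_id (1 : Q) *%g.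

(* [baseGroupType] only provides the operations *, 1 and ^-1, without axioms;
   in particular two-sided inverses need not be unique, and ^-1 is an arbitrary
   selection of them. *)
Definition has_inverses (Q : baseGroupType) : Prop :=
  right_inverse (1 : Q) inv *%g /\ left_inverse (1 : Q) inv *%g.

(* When x and y are the specified elements, x * y = z has a unique solution z
   because * is a function. *)
Definition is_loop (Q : baseUMagmaType) : Prop :=
  [/\ has_neutral Q,
      forall x z : Q, exists! y : Q, x * y = z
    & forall y z : Q, exists! x : Q, x * y = z].

(* Main.v *)
Require Import Defs.
From mathcomp Require Import all_boot.

(** Write [L_x] and [R_x] for the left and right translations by [x], and [x']
    for an inverse of [x].

    The left Bol identity says [L_(x(yx)) = L_x L_y L_x]; in particular
    [L_(xx) = L_x L_x].  Since [x((x'x')x) = x(x'(x'x)) = 1], taking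
    [y = x'x'] gives [L_x L_x' L_x' L_x = id].  Thus [L_x] has both a left and a
    right inverse, and since moreover [L_x L_x' L_x = L_x], its inverse is [L_x']
    (the left inverse property, [left_bol_lip]).  The equation [xy = z], which
    amounts to [L_y L_x L_y = L_(yz)], can then be solved for [L_x], hence for
    [x = L_x 1] ([left_bol_division]).

    Each Moufang identity implies flexibility, [(xy)x = x(yx)], when one variable
    is set to [1].  Modulo flexibility, (M1) is the left Bol identity and (M2) is
    its mirror image, so both reduce to the left Bol case, (M2) through the
    opposite magma.

    The identity (C) implies both alternative laws and then says that squares lie
    in the middle nucleus.  As [xx] and [x'x'] are mutually inverse,
    [R_(xx) = R_x R_x] is invertible, hence so is [R_x]; since (C) is its own
    mirror image, so is [L_x] ([c_division]).

    The lemmas are stated for a bare binary operation so that they apply to an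
    operation and to its opposite alike. *)

Lemma two_sided_inverse_solve {A B : Type} {f : A -> B} {g h : B -> A} :
  cancel f g -> cancel h f -> forall z, exists! x, f x = z.
Proof.
move=> fK hK z; exists (h z); split=> [|x <-]; first exact: hK.
by apply: (can_inj fK); rewrite hK.
Qed.

Definition has_division {T : Type} (op : T -> T -> T) : Prop :=
  (forall x z, exists! y, op x y = z) /\ (forall y z, exists! x, op x y = z).

Lemma has_division_opp {T : Type} (op : T -> T -> T) :
  has_division (fun x y => op y x) -> has_division op.
Proof. by case=> hl hr; split. Qed.

(** * The left Bol identity *)

Definition left_bol {T : Type} (op : T -> T -> T) : Prop :=
  forall x y z, op (op x (op y x)) z = op x (op y (op x z)).

(** This is [L_x L_x' L_x' L_x = id], the instance [y = x'x'] of the identity: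
    it is what makes translations both injective and surjective. *)
Lemma left_bol_sandwich {T : Type} {op : T -> T -> T} {e : T} {i : T -> T} :
  left_id e op -> right_id e op -> right_inverse e i op ->
  left_inverse e i op -> left_bol op ->
  forall x z, op x (op (i x) (op (i x) (op x z))) = z.
Proof.
move=> e1 e2 i2 i1 bol x z.
have sq a b : op (op a a) b = op a (op a b).
  by have := bol a e b; rewrite !e1.
by rewrite -sq -bol sq i1 e2 i2 e1.
Qed.

Lemma left_bol_inj {T : Type} {op : T -> T -> T} {e : T} {i : T -> T} :
  left_id e op -> right_id e op -> right_inverse e i op ->
  left_inverse e i op -> left_bol op -> forall x, injective (op x).
Proof.
move=> e1 e2 i2 i1 bol x.
apply: (can_inj (g := fun z => op x (op (i x) (op (i x) z)))) => z.
exact: (left_bol_sandwich e1 e2 i2 i1 bol).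
Qed.

(** [L_x L_x' L_x = L_x] because [x(x'x) = x], and [L_x' L_x L_x' = L_x']
    likewise; now cancel the leftmost translation on each side. *)
Lemma left_bol_lip {T : Type} {op : T -> T -> T} {e : T} {i : T -> T} :
  left_id e op -> right_id e op -> right_inverse e i op ->
  left_inverse e i op -> left_bol op ->
  forall x, cancel (op x) (op (i x)) /\ cancel (op (i x)) (op x).
Proof.
move=> e1 e2 i2 i1 bol x.
have inj := left_bol_inj e1 e2 i2 i1 bol.
split=> z.
- by apply: (inj x); rewrite -bol i1 e2.
- by apply: (inj (i x)); rewrite -bol i2 e2.
Qed.

(** By the left inverse property [xy = z] iff [y(xy) = yz], and then
    [L_y L_x L_y = L_(yz)]; evaluating [L_x = L_y' L_(yz) L_y'] at [1] gives the
    only candidate [x = y'((yz)y')]. *)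
Lemma left_bol_division {T : Type} {op : T -> T -> T} {e : T} {i : T -> T} :
  left_id e op -> right_id e op -> right_inverse e i op ->
  left_inverse e i op -> left_bol op -> has_division op.
Proof.
move=> e1 e2 i2 i1 bol.
have lip := left_bol_lip e1 e2 i2 i1 bol.
split=> [x|y].
  by have [fK hK] := lip x; apply: (two_sided_inverse_solve fK hK).
have [yK y'K] := lip y.
apply: (two_sided_inverse_solve
          (g := fun z => op (i y) (op (op y z) (i y)))
          (h := fun z => op (i y) (op (op y z) (i y)))) => [x|z].
- by rewrite bol i2 e2 yK.
- by rewrite bol i1 e2 yK.
Qed.

(** * The C identity *)

Definition c_law {T : Type} (op : T -> T -> T) : Prop :=
  forall x y z, op x (op y (op y z)) = op (op (op x y) y) z.

(** Put [s = yy] and [t = y'y'].  The alternative laws give [st = ts = 1], and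
    (C) becomes [x(sz) = (xs)z]; hence [R_s] and [R_t] are mutually inverse,
    while [R_s = R_y R_y]. *)
Lemma c_right_division {T : Type} {op : T -> T -> T} {e : T} {i : T -> T} :
  left_id e op -> right_id e op -> right_inverse e i op ->
  left_inverse e i op -> c_law op -> forall y z, exists! x, op x y = z.
Proof.
move=> e1 e2 i2 i1 c y.
have ralt a b : op a (op b b) = op (op a b) b.
  by have := c a b e; rewrite !e2.
have lalt a b : op a (op a b) = op (op a a) b.
  by have := c e a b; rewrite !e1.
have sq_inv : op (op y y) (op (i y) (i y)) = e.
  by rewrite ralt -(lalt y) i2 e2 i2.
have inv_sq : op (op (i y) (i y)) (op y y) = e.
  by rewrite ralt -(lalt (i y)) i1 e2 i1.
apply: (two_sided_inverse_solve
          (g := fun z => op (op z y) (op (i y) (i y)))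
          (h := fun z => op (op z (op (i y) (i y))) y)) => [x|z].
- by rewrite -c lalt sq_inv e2.
- by rewrite -ralt (ralt z) -c lalt inv_sq e2.
Qed.

Lemma c_division {T : Type} {op : T -> T -> T} {e : T} {i : T -> T} :
  left_id e op -> right_id e op -> right_inverse e i op ->
  left_inverse e i op -> c_law op -> has_division op.
Proof.
move=> e1 e2 i2 i1 c; split; last exact: (c_right_division e1 e2 i2 i1 c).
(* (C) and its mirror image are the same identity, read in opposite ways. *)
apply: (c_right_division (op := fun x y => op y x) e2 e1 i1 i2) => x y z.
by rewrite c.
Qed.

(** * Conclusion *)

Theorem theorem1p1 (Q : baseGroupType) (hneutral : has_neutral Q)
    (hinverses : has_inverses Q) (hid : LB Q \/ M1 Q \/ M2 Q \/ C Q) :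
  is_loop Q.
Proof.
have [e1 e2] := hneutral; have [i2 i1] := hinverses.
suff [hl hr] : has_division (fun x y : Q => (x * y)%g) by split.
case: hid => [lb|[m1|[m2|c]]].
- exact: (left_bol_division e1 e2 i2 i1).
- apply: (left_bol_division e1 e2 i2 i1) => x y z.
  have flex : ((x * y) * x = x * (y * x))%g by have := m1 x y 1%g; rewrite !e2.
  by rewrite -flex m1.
- apply: has_division_opp.
  apply: (left_bol_division (op := fun x y : Q => (y * x)%g) e2 e1 i1 i2).
  move=> x y z.
  have flex : (x * (y * x) = (x * y) * x)%g by have := m2 1%g x y; rewrite !e1.
  by rewrite -flex m2.
- exact: (c_division e1 e2 i2 i1).
Qed.
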